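(* Let $A\in\mathbb{R}^{l\times m}$, $B\in\mathbb{R}^{n\times m}$ with $C=\ker A\cap\mathbb{R}^m_>\neq\emptyset$ and $d_P=d$, and let $v^1,\ldots,v^{n_P}$, $T$, $D$ and $F\colon\mathbb{R}^{d_P}\to\mathbb{R}^d_>$ be as defined in the context. The map $F$ is not proper if and only if there is a nonzero $t\in T$ such that \[ \mu^{\max}(t)\in D^\perp, \] where $\mu^{\max}(t)\in\mathbb{R}^m$ has components \[ \mu_j^{\max}(t)=\max_{k\colon v_j^k\neq0}\,v^k\cdot t,\qquad j=1,\ldots,m . \]
   Context: Notation: $\mathbb{R}_>$ are the positive reals, $\mathbb{R}_\ge$ the nonnegative reals, $1_m\in\mathbb{R}^m$ is the all-ones vector. For $x\in\mathbb{R}^m_>$ and $y\in\mathbb{R}^m$, $x^y=\prod_i x_i^{y_i}$; for a matrix $Y=(y^1,\ldots,y^r)\in\mathbb{R}^{m\times r}$ with columns $y^j$, $x^Y\in\mathbb{R}^r_>$ has components $(x^Y)_j=x^{y^j}$. Coefficient polytope: $P=C\cap\Delta$ with $C=\ker A\cap\mathbb{R}^m_>$ (assumed nonempty) and $\Delta=\{y\in\mathbb{R}^m_\ge\mid 1_m\cdot y=1\}$; $d_P=\dim P$. $P$ is relatively open; its closure $\overline P$ is a polytope with vertices $v^1,\ldots,v^{n_P}\in\mathbb{R}^m$. Subspaces: $\mathcal{A}=\begin{pmatrix}A\\1_m^{\mathsf T}\end{pmatrix}$, $T=\ker\mathcal{A}$ (of dimension $d_P$), $T=\operatorname{im}G$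 with $G\in\mathbb{R}^{m\times d_P}$ having orthonormal columns. $\mathcal{B}=\begin{pmatrix}B\\1_m^{\mathsf T}\end{pmatrix}$, $D=\ker\mathcal{B}$, $d=\dim D$, $D=\operatorname{im}H$ with basis matrix $H\in\mathbb{R}^{m\times d}$. Standing assumption: $d_P=d$. Parametrization $p\colon\mathbb{R}^{d_P}\to P$ (a real analytic isomorphism) and map $F$: \[ p(\xi)=\frac{\sum_{k=1}^{n_P}\mathrm{e}^{v^k\cdot G\xi}\,v^k}{\sum_{k=1}^{n_P}\mathrm{e}^{v^k\cdot G\xi}},\qquad F\colon\mathbb{R}^{d_P}\to\mathbb{R}^d_>,\quad F(\xi)=p(\xi)^H . \] A map $\Psi\colon X\to Y$ is proper if $\Psi^{-1}(K)$ is compact for every compact $K\subseteq Y$. *)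

(* Defs.v *)
From HB Require Import structures.
From mathcomp Require Import all_boot all_order all_algebra.
From mathcomp Require Import all_classical all_reals all_analysis.
Import Order.TTheory GRing.Theory Num.Theory.
Import numFieldNormedType.Exports.

Set Implicit Arguments.
Unset Strict Implicit.
Unset Printing Implicit Defensive.

Local Open Scope classical_set_scope.
Local Open Scope ring_scope.

(* Vectors are columns and matrices act by left multiplication. *)

Section LinearAlgebra.
Context {R : realType}.

Definition dotv (m : nat) (x y : 'cV[R]_m) : R := \sum_(i < m) x i 0 * y i 0.

Definition ones (m : nat) : 'cV[R]_m := const_mx 1.

Definition mx_ker (n m : nat) (M : 'M[R]_(n, m)) : set 'cV[R]_m :=
  [set x | M *m x = 0].

Definition mx_im (m k : nat) (M : 'M[R]_(m, k)) : set 'cV[R]_m :=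
  range (fun x : 'cV[R]_k => M *m x).

Definition orth_compl (m : nat) (S : set 'cV[R]_m) : set 'cV[R]_m :=
  [set y | forall x, S x -> dotv y x = 0].

Definition orthonormal_cols (m k : nat) (M : 'M[R]_(m, k)) : Prop :=
  M^T *m M = 1%:M.

Definition basis_mx (m k : nat) (M : 'M[R]_(m, k)) (S : set 'cV[R]_m) : Prop :=
  row_free M^T /\ mx_im M = S.

Definition aug_mx (n m : nat) (M : 'M[R]_(n, m)) : 'M[R]_(n + 1, m) :=
  col_mx M (ones m)^T.

Definition pos_orthant (m : nat) : set 'cV[R]_m :=
  [set x : 'cV[R]_m | forall i, 0 < x i 0].

Definition simplex (m : nat) : set 'cV[R]_m :=
  [set y : 'cV[R]_m | (forall i, 0 <= y i 0) /\ dotv (ones m) y = 1].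

Definition vpow (m : nat) (x y : 'cV[R]_m) : R := \prod_(i < m) x i 0 `^ y i 0.

Definition mxpow (m r : nat) (x : 'cV[R]_m) (Y : 'M[R]_(m, r)) : 'cV[R]_r :=
  \col_j vpow x (col j Y).

End LinearAlgebra.

Arguments pos_orthant {R} m _.
Arguments simplex {R} m _.

Section Polytopes.
Context {R : realType}.

Definition affine_hull (m : nat) (S : set 'cV[R]_m) : set 'cV[R]_m :=
  [set x | exists (k : nat) (a : 'I_k -> R) (y : 'I_k -> 'cV[R]_m),
    [/\ forall i, S (y i), \sum_i a i = 1 & x = \sum_i a i *: y i]].

(* No natural number is the dimension of the empty set. *)
Definition has_dim (m : nat) (S : set 'cV[R]_m) (k : nat) : Prop :=
  exists (x0 : 'cV[R]_m) (U : {vspace 'cV[R]_m}),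
    \dim U = k /\ affine_hull S = [set x0 + u | u in [set u | u \in U]].

(* For a polytope, the extreme points are exactly the vertices. *)
Definition extreme_points (m : nat) (S : set 'cV[R]_m) : set 'cV[R]_m :=
  [set x | S x /\ forall (y z : 'cV[R]_m) (a : R), S y -> S z -> 0 < a < 1 ->
    x = a *: y + (1 - a) *: z -> y = x /\ z = x].

Definition enumerates_vertices (m k : nat) (v : 'I_k -> 'cV[R]_m)
    (S : set 'cV[R]_m) : Prop :=
  injective v /\ range v = extreme_points S.

Definition coef_cone (l m : nat) (A : 'M[R]_(l, m)) : set 'cV[R]_m :=
  mx_ker A `&` pos_orthant m.

Definition coef_polytope (l m : nat) (A : 'M[R]_(l, m)) : set 'cV[R]_m :=
  coef_cone A `&` simplex m.

End Polytopes.

(* A map f : X -> Y, where Y is a subset of the topological space V.  The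
   compact subsets of the subspace Y are the compact subsets of V that are
   contained in Y. *)
Definition proper_into (X V : topologicalType) (Y : set V) (f : X -> V) : Prop :=
  forall K : set V, K `<=` Y -> compact K -> compact (f @^-1` K).

Section Parametrization.
Context {R : realType}.

Definition param (m nP dP : nat) (v : 'I_nP -> 'cV[R]_m) (G : 'M[R]_(m, dP))
    (xi : 'cV[R]_dP) : 'cV[R]_m :=
  (\sum_(k < nP) expR (dotv (v k) (G *m xi)))^-1 *:
    \sum_(k < nP) expR (dotv (v k) (G *m xi)) *: v k.

Definition Fmap (m nP dP d : nat) (v : 'I_nP -> 'cV[R]_m) (G : 'M[R]_(m, dP))
    (H : 'M[R]_(m, d)) (xi : 'cV[R]_dP) : 'cV[R]_d :=
  mxpow (param v G xi) H.

(* The maximum of f over the indices satisfying Q; the value 0 is used only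
   when no index satisfies Q. *)
Definition max_over (k : nat) (Q : pred 'I_k) (f : 'I_k -> R) : R :=
  if [pick i | Q i] is Some i0 then \big[Num.max/f i0]_(i | Q i) f i else 0.

(* If v enumerates the vertices of the closure of a polytope that contains a
   positive vector, then every maximum below is over a nonempty set. *)
Definition mumax (m nP : nat) (v : 'I_nP -> 'cV[R]_m) (t : 'cV[R]_m) :
    'cV[R]_m :=
  \col_j max_over (fun k => v k j 0 != 0) (fun k => dotv (v k) t).

End Parametrization.

(* Main.v *)
Require Import Defs.
From HB Require Import structures.
From mathcomp Require Import all_boot all_order all_algebra.
From mathcomp Require Import all_classical all_reals all_analysis.
From mathcomp Require Import ring lra.
Import Order.TTheory GRing.Theory Num.Theory.
Import numFieldNormedType.Exports.
Local Open Scope classical_set_scope.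
Local Open Scope ring_scope.

(** Each coordinate of [F] is a product of powers of coordinates of [p(xi)].  The
    common denominator of [p(xi)] cancels, because every column of [H] sums to
    zero ([Fmap_lse]); hence, with [L_j(x) = ln (sum_k v^k_j exp (v^k . x))],
    [ln F(xi)] is [H^T] applied to the vector of the [L_j(G xi)].  A function of
    this log-sum-exp form differs from the maximum of the [v^k . x] over the
    indices with nonzero weight by at most a constant ([lse_max_bound]).
    Therefore
      [ln F(xi) = H^T mumax(G xi) + O(1)]
    uniformly in [xi] ([ln_Fmap_mumax_bound]).

    The map [g(xi) = H^T mumax(G xi)] is continuous and positively homogeneous,
    so it either vanishes on a whole ray or satisfies [sum_i |g_i(xi)| >= c |xi|]
    with [c > 0], by compactness of the unit sphere ([homogeneous_coercive]).  In
    the first case [F] stays in a compact box of the open orthant along an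
    unbounded ray, so it is not proper ([not_proper_of_recession]).  In the
    second, since [ln] is bounded on compact subsets of the open orthant, their
    preimages are bounded, and closed by continuity ([proper_of_no_recession]).
    Finally, [t = G xi] runs through [T], injectively, and [g(xi) = 0] says that
    [mumax(t)] is orthogonal to [D = im H] ([orth_compl_im]).

    The estimates need the vertices to be nonnegative and, for every coordinate
    [j], some vertex with nonzero [j]-th coordinate.  The latter comes from
    maximizing a strictly convex function over the closed polytope: a maximizer
    is an extreme point ([extreme_point_of_max_convex]), and the function can be
    chosen so that its maximizers avoid the face [x_j = 0]
    ([exists_extreme_point_coord]). *)

(** * Topology of spaces of column vectors *)

Lemma continuous_mx {T : topologicalType} {K : numFieldType} {m n : nat}
    (f : T -> 'M[K]_(m, n)) :
  (forall i j, continuous (fun x => f x i j)) -> continuous f.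
Proof.
move=> cf x A [P fxP PA].
apply: (@filterS _ (nbhs x) _ [set y | forall i j, P i j (f y i j)]).
  by move=> y; exact: PA.
by do 2!apply: filter_forall => ?; apply: cf; exact: fxP.
Qed.

Lemma coord_le_norm {R : realType} {m n : nat} (x : 'M[R]_(m, n)) i j :
  `|x i j| <= `|x|.
Proof.
rewrite {2}/Num.norm /= mx_normrE.
exact: (le_bigmax _ (fun ij => `|x ij.1 ij.2|) (i, j)).
Qed.

Lemma norm_le_coord {R : realType} {m n : nat} (x : 'M[R]_(m, n)) (M : R) :
  0 <= M -> (forall i j, `|x i j| <= M) -> `|x| <= M.
Proof.
move=> M0 xM; rewrite {1}/Num.norm /= mx_normrE.
by apply/bigmax_leP; split=> // -[i j] _ /=.
Qed.

(** Heine-Borel for columns, transported from rows along the transpose. *)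
Lemma cV_compact {R : realType} {n : nat} (S : set 'cV[R]_n) :
  bounded_set S -> closed S -> compact S.
Proof.
move=> [M [Mreal SM]] Sc.
have trc p q : continuous (@trmx R p q).
  apply: continuous_mx => i j; under eq_fun do rewrite mxE.
  exact: coord_continuous.
have normT (x : 'rV[R]_n) : `|x| <= `|x^T|.
  by apply: norm_le_coord => // i j; rewrite -[x]trmxK mxE trmxK coord_le_norm.
have -> : S = trmx @` (trmx @^-1` S).
  by apply/seteqP; split=> [x Sx|_ [y Sy <-]//]; exists x^T; rewrite /= trmxK.
apply: continuous_compact; first by apply: continuous_subspaceT => x; exact: trc.
apply: bounded_closed_compact; last first.
  by apply: preimage_closed => // x _; exact: trc.
by exists M; split=> // N MN x Sx /=; apply: le_trans (normT x) _; exact: SM.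
Qed.

(** The constant is the minimum of [f] on the unit sphere, and homogeneity spreads
    the bound to all of the space.  When the sphere is empty the space is zero. *)
Lemma homogeneous_coercive {R : realType} {n : nat} (f : 'cV[R]_n -> R) :
  continuous f -> (forall s x, 0 <= s -> f (s *: x) = s * f x) ->
  (forall x, x != 0 -> 0 < f x) ->
  exists2 c, 0 < c & forall x, c * `|x| <= f x.
Proof.
move=> fc fh fpos; pose S := [set x : 'cV[R]_n | `|x| = 1].
have f0 : f 0 = 0 by rewrite -(scale0r 0) fh// mul0r.
have unitP x : x != 0 -> S (`|x|^-1 *: x).
  by move=> x0; rewrite /S /= normrZ normfV normr_id mulVf ?normr_eq0.
have [S0|/set0P/negP] := pselect (S !=set0); last first.
  rewrite negbK => /eqP S0; exists 1 => // x.
  have [->|/unitP] := eqVneq x 0; first by rewrite normr0 mulr0 f0.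
  by rewrite S0.
have Sc : compact S.
  apply: cV_compact; first by exists 1; split=> // N N1 x /= ->; exact: ltW.
  apply: (@preimage_closed _ _ (fun x : 'cV[R]_n => `|x|) [set y | y = 1]).
    by move=> x _; exact: norm_continuous.
  exact: closed_eq.
have [c cS cmin] := compact_EVT_min S0 Sc (continuous_subspaceT fc).
have c0 : c != 0.
  move: cS; rewrite inE /S /= => c1; rewrite -normr_eq0 c1; exact: oner_neq0.
exists (f c) => [|x]; first exact: fpos.
have [->|x0] := eqVneq x 0; first by rewrite normr0 mulr0 f0.
have nx : 0 < `|x| by rewrite normr_gt0.
have := cmin _ (mem_set (unitP x x0)).
by rewrite fh ?invr_ge0// ler_pdivlMl// mulrC.
Qed.

(** * Maxima over a set of indices *)

Lemma max_over_attained {R : realType} {k : nat} (Q : pred 'I_k)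
    (f : 'I_k -> R) i : Q i -> exists2 j, Q j & max_over Q f = f j.
Proof.
rewrite /max_over; case: pickP => [i0 Qi0 _|Q0]; last by rewrite Q0.
elim/big_ind: _ => [|x y [a Qa ->] [b Qb ->]|j Qj]; first by exists i0.
  by have [_|_] := leP (f a) (f b); [exists b|exists a].
by exists j.
Qed.

Lemma max_over_ge {R : realType} {k : nat} (Q : pred 'I_k)
    (f : 'I_k -> R) i : Q i -> f i <= max_over Q f.
Proof.
rewrite /max_over; case: pickP => [i0 _ Qi|->//].
exact: le_bigmax_cond.
Qed.

Lemma max_over_scale {R : realType} {k : nat} (Q : pred 'I_k)
    (s : R) (f : 'I_k -> R) :
  0 <= s -> max_over Q (fun i => s * f i) = s * max_over Q f.
Proof.
move=> s0; rewrite /max_over; case: pickP => [i0 _|_]; last by rewrite mulr0.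
by elim/big_rec2: _ => // i x y _ ->; rewrite maxr_pMr.
Qed.

Lemma max_over_continuous {R : realType} {T : topologicalType} {k : nat}
    (Q : pred 'I_k) (f : T -> 'I_k -> R) :
  (forall i, continuous (f^~ i)) -> continuous (fun x => max_over Q (f x)).
Proof.
move=> fc; rewrite /max_over; case: pickP => [i0 _|_ x]; last exact: cvg_cst.
elim: (index_enum _) => [|i s IH].
  by rewrite [X in continuous X](_ : _ = f^~ i0)//; apply/funext=> x; rewrite big_nil.
rewrite [X in continuous X](_ : _ = fun x => if Q i
    then Num.max (f x i) (\big[Num.max/f x i0]_(j <- s | Q j) f x j)
    else \big[Num.max/f x i0]_(j <- s | Q j) f x j); last first.
  by apply/funext=> x; rewrite big_cons.
by case: (Q i) => // x; apply: continuous_max; [exact: fc|exact: IH].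
Qed.

(** * Continuity of sums and linear maps *)

Lemma continuous_scale {R : realType} {T : topologicalType} (c : R)
    (f : T -> R) : continuous f -> continuous (fun x => c * f x).
Proof.
move=> fc x; apply: (@continuous_comp _ _ _ f ( *%R c)); first exact: fc.
exact: mulrl_continuous.
Qed.

Lemma continuous_sum {R : realType} {T : topologicalType} {n : nat}
    (f : 'I_n -> T -> R) :
  (forall i, continuous (f i)) -> continuous (fun x => \sum_i f i x).
Proof.
by move=> fc; apply: continuous_big => // x; exact: add_continuous.
Qed.

Lemma continuous_mulmx {R : realType} {n k : nat} (M : 'M[R]_(n, k)) :
  continuous (fun x : 'cV[R]_k => M *m x).
Proof.
apply: continuous_mx => i j.
rewrite [X in continuous X](_ : _ = fun x : 'cV[R]_k => \sum_p M i p * x p j); last first.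
  by apply/funext=> x; rewrite mxE.
apply: continuous_sum => p; apply: continuous_scale.
exact: coord_continuous.
Qed.

Lemma continuous_dotv {R : realType} {m : nat} (u : 'cV[R]_m) :
  continuous (dotv u).
Proof.
apply: continuous_sum => i; apply: continuous_scale.
exact: coord_continuous.
Qed.

(** * Extreme points of compact subsets of the simplex *)

Lemma dotvZ {R : realType} {m : nat} (u x : 'cV[R]_m) (s : R) :
  dotv u (s *: x) = s * dotv u x.
Proof.
by rewrite /dotv mulr_sumr; apply: eq_bigr => i _; rewrite mxE; ring.
Qed.

Lemma simplex_closed {R : realType} {m : nat} : closed (@simplex R m).
Proof.
have -> : @simplex R m =
    (\bigcap_(i in setT) [set y : 'cV[R]_m | 0 <= y i 0]) `&`
    (dotv (ones m) @^-1` [set s | s = 1]).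
  apply/seteqP; split=> [y [y0 y1]|y [y0 y1]]; split=> // i; last exact: y0.
  by move=> _; exact: y0.
apply: closedI; last first.
  by apply: preimage_closed => [x _|]; [exact: continuous_dotv|exact: closed_eq].
apply: closed_bigI => i _.
apply: (@preimage_closed _ _ (fun y : 'cV[R]_m => y i 0) [set s | 0 <= s]).
  by move=> x _; exact: coord_continuous.
exact: closed_ge.
Qed.

Lemma simplex_coord_le1 {R : realType} {m : nat} (y : 'cV[R]_m) i :
  simplex m y -> y i 0 <= 1.
Proof.
move=> [y0]; rewrite /dotv (bigD1 i)//= mxE mul1r => <-.
by rewrite lerDl sumr_ge0// => j _; rewrite mxE mul1r.
Qed.

Lemma simplex_bounded {R : realType} {m : nat} : bounded_set (@simplex R m).
Proof.
exists 1; split=> // M M1 y ys /=; apply: norm_le_coord => [|i j].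
  by apply: le_trans (ltW M1).
rewrite ord1 ger0_norm; last exact: ys.1.
by apply: le_trans (ltW M1); exact: simplex_coord_le1.
Qed.

Lemma simplex_dotv_le1 {R : realType} {m : nat} (y : 'cV[R]_m) :
  simplex m y -> dotv y y <= 1.
Proof.
move=> ys; rewrite -ys.2; apply: ler_sum => i _; rewrite [ones m i 0]mxE.
by apply: ler_wpM2r; [exact: ys.1|exact: simplex_coord_le1].
Qed.

(** The function [y |-> u . y + |y|^2] is strictly convex: at
    [x = a y + (1 - a) z] it falls short of the convex combination of its values
    at [y] and [z] by exactly [a (1 - a) |y - z|^2].  Maximality of [x] forces
    this deficit to vanish. *)
Lemma extreme_point_of_max_convex {R : realType} {m : nat} (S : set 'cV[R]_m)
    (u x : 'cV[R]_m) :
  S x -> (forall y, S y -> dotv u y + dotv y y <= dotv u x + dotv x x) ->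
  extreme_points S x.
Proof.
move=> Sx xmax; split=> // y z a Sy Sz /andP[a0 a1] xyz.
have phiE : dotv u x + dotv x x = a * (dotv u y + dotv y y)
    + (1 - a) * (dotv u z + dotv z z) - a * (1 - a) * dotv (y - z) (y - z).
  rewrite /dotv -!big_split /= !mulr_sumr -big_split -sumrB /=.
  by apply: eq_bigr => i _; rewrite xyz !mxE; ring.
have a1' : 0 < 1 - a by rewrite subr_gt0.
have yz0 : dotv (y - z) (y - z) <= 0.
  rewrite -(@pmulr_rle0 _ (a * (1 - a))) ?mulr_gt0//.
  have phiy := ler_wpM2l (ltW a0) (xmax _ Sy).
  have phiz := ler_wpM2l (ltW a1') (xmax _ Sz).
  lra.
have yz : y = z.
  have sq (p : 'I_m) : true -> 0 <= (y - z) p 0 * (y - z) p 0.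
    by rewrite -expr2 sqr_ge0.
  have /psumr_eq0P/(_ _) yz_eq0 : dotv (y - z) (y - z) = 0.
    by apply/le_anti; rewrite yz0 sumr_ge0.
  apply/matrixP => i j; rewrite ord1; apply/eqP; rewrite -subr_eq0.
  by have /eqP := yz_eq0 sq i isT; rewrite -expr2 sqrf_eq0 !mxE.
by rewrite xyz yz -scalerDl addrCA subrr addr0 scale1r.
Qed.

(** Maximize [phi(x) = x_j / p_j + |x|^2].  On the simplex [|x|^2 <= 1], so
    [phi <= 1] where [x_j = 0], while [phi(p) = 1 + |p|^2 > 1].  Thus a maximizer,
    which is an extreme point, has [x_j] nonzero. *)
Lemma exists_extreme_point_coord {R : realType} {m : nat}
    (S : set 'cV[R]_m) (p : 'cV[R]_m) (j : 'I_m) :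
  compact S -> S `<=` simplex m -> S p -> 0 < p j 0 ->
  exists2 x, extreme_points S x & x j 0 != 0.
Proof.
move=> Sc Ssub Sp pj.
pose u : 'cV[R]_m := (p j 0)^-1 *: delta_mx j 0.
have uE (x : 'cV[R]_m) : dotv u x = (p j 0)^-1 * x j 0.
  rewrite /dotv (bigD1 j)//= big1 => [|i ij].
    by rewrite addr0 !mxE !eqxx mulr1.
  by rewrite !mxE (negbTE ij) mulr0 mul0r.
have sqc : continuous (fun x : 'cV[R]_m => dotv x x).
  apply: continuous_sum => i x.
  by apply: continuousM; exact: coord_continuous.
have phic : continuous (fun x : 'cV[R]_m => dotv u x + dotv x x).
  move=> x; exact: (@cvgD _ _ _ _ _ _ _ _ _ (@continuous_dotv _ _ u x) (sqc x)).
have [|x Sx xmax] := compact_EVT_max _ Sc (continuous_subspaceT phic).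
  by exists p.
exists x.
  apply: (@extreme_point_of_max_convex _ _ _ u); first exact: set_mem.
  by move=> y Sy; apply: xmax; exact: mem_set.
apply/eqP => xj0.
have := xmax _ (mem_set Sp); rewrite !uE xj0 mulr0 mulVf ?gt_eqF// add0r.
have /simplex_dotv_le1 xx := Ssub _ (set_mem Sx).
have : 0 < dotv p p.
  rewrite /dotv (bigD1 j)//= ltr_pwDl ?mulr_gt0// sumr_ge0// => i _.
  by rewrite -expr2 sqr_ge0.
by move=> pp le; have := le_trans le xx; rewrite gerDl leNgt pp.
Qed.

Lemma closure_coef_polytope_sub_simplex {R : realType} {l m : nat}
    (A : 'M[R]_(l, m)) : closure (coef_polytope A) `<=` simplex m.
Proof.
rewrite (closure_id (simplex m)).1; last exact: simplex_closed.
by apply: closure_subset => x [].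
Qed.

(** An element of the cone, rescaled to coordinate sum one, is a point of the
    polytope with positive coordinates. *)
Lemma closure_coef_polytope_vertex {R : realType} {l m : nat}
    (A : 'M[R]_(l, m)) (j : 'I_m) : coef_cone A !=set0 ->
  exists2 x, extreme_points (closure (coef_polytope A)) x & x j 0 != 0.
Proof.
move=> [c [Ac c0]].
have s0 : 0 < dotv (ones m) c.
  rewrite /dotv (bigD1 j)//= ltr_pwDl//; first by rewrite mxE mul1r; exact: c0.
  by rewrite sumr_ge0// => i _; rewrite mxE mul1r ltW//; exact: c0.
pose p := (dotv (ones m) c)^-1 *: c.
have p0 i : 0 < p i 0 by rewrite mxE mulr_gt0 ?invr_gt0//; exact: c0.
apply: (@exists_extreme_point_coord _ _ _ p) => //.
- apply: cV_compact; last exact: closed_closure.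
  have [M [Mreal sM]] := @simplex_bounded R m.
  exists M; split=> // N MN x Sx; apply: (sM N MN).
  exact: closure_coef_polytope_sub_simplex Sx.
- exact: closure_coef_polytope_sub_simplex.
- apply: subset_closure; split; split=> //.
  + by rewrite /mx_ker /= -scalemxAr Ac scaler0.
  + by move=> i; exact: ltW.
  + by rewrite dotvZ mulVf// gt_eqF.
Qed.

(** * Logarithms of sums of exponentials *)

Lemma lse_gt0 {R : realType} {k : nat} (w a : 'I_k -> R) :
  (forall i, 0 <= w i) -> (exists i, w i != 0) ->
  0 < \sum_i w i * expR (a i).
Proof.
move=> w0 [i wi]; rewrite (bigD1 i)//= ltr_pwDl//.
  by rewrite mulr_gt0 ?expR_gt0// lt0r wi w0.
by rewrite sumr_ge0// => p _; rewrite mulr_ge0// expR_ge0.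
Qed.

(** Tropicalization: with [M] the maximum of the [a i] and [j] an index attaining
    it, the sum lies between [w j * e^M] and [(sum of the weights) * e^M].  The
    constant must not depend on [a], hence not on [j]: so all the [|ln (w i)|]
    enter it. *)
Lemma lse_max_bound {R : realType} {k : nat} (w : 'I_k -> R) :
  (forall i, 0 <= w i) -> (exists i, w i != 0) ->
  exists C, forall a : 'I_k -> R,
    `|ln (\sum_i w i * expR (a i)) - max_over (fun i => w i != 0) a| <= C.
Proof.
move=> w0 wn0; have [i0 wi0] := wn0.
exists (\sum_i `|ln (w i)| + `|ln (\sum_i w i)|) => a.
have wgt0 i : w i != 0 -> 0 < w i by move=> wi; rewrite lt0r wi w0.
have sumw : 0 < \sum_i w i.
  by rewrite (bigD1 i0)//= ltr_pwDl ?wgt0// sumr_ge0.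
have S0 := lse_gt0 w a w0 wn0.
set S := \sum_i _ in S0 *.
have maxge i : w i != 0 -> a i <= max_over (fun i => w i != 0) a.
  exact: (@max_over_ge _ _ (fun i => w i != 0)).
have [j wj maxE] := @max_over_attained _ _ (fun i => w i != 0) a i0 wi0.
move: (max_over _ _) maxge maxE => M maxge maxE.
have lnle x y : 0 < x -> x <= y -> ln x <= ln y :> R.
  by move=> x0 xy; rewrite ler_ln ?posrE//; exact: lt_le_trans xy.
(* Upper bound: replace every [a i] by [M]. *)
have up : ln S <= ln (\sum_i w i) + M.
  rewrite -[M]expRK -lnM ?posrE ?expR_gt0//; apply: lnle => //.
  rewrite mulr_suml; apply: ler_sum => i _.
  have [->|wi] := eqVneq (w i) 0; first by rewrite !mul0r.
  by rewrite ler_pM2l ?wgt0// ler_expR maxge.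
(* Lower bound: keep only the term of index [j], where [a] attains its maximum. *)
have low : ln (w j) + M <= ln S.
  rewrite -[M]expRK -lnM ?posrE ?expR_gt0 ?wgt0//.
  apply: lnle; first by rewrite mulr_gt0 ?expR_gt0 ?wgt0.
  rewrite /S (bigD1 j)//= -maxE lerDl sumr_ge0// => i _.
  by rewrite mulr_ge0// expR_ge0.
have lnj : `|ln (w j)| <= \sum_i `|ln (w i)|.
  by rewrite (bigD1 j)//= lerDl sumr_ge0.
have := ler_norm (ln (\sum_i w i)); have := ler_norm (- ln (w j)).
rewrite normrN; have := normr_ge0 (ln (\sum_i w i)).
have := normr_ge0 (ln (w j)).
by rewrite ler_norml; lra.
Qed.

(** * Asymptotics of the map F *)

Lemma powR_pos {R : realType} (a x : R) : 0 < a -> a `^ x = expR (x * ln a).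
Proof. by move=> a0; rewrite /powR gt_eqF. Qed.

(** The normalizing denominator of [param] contributes a multiple of the sum of
    the [i]-th column of [H], which is zero. *)
Lemma Fmap_lse {R : realType} {m nP dP d : nat} (v : 'I_nP -> 'cV[R]_m)
    (G : 'M[R]_(m, dP)) (H : 'M[R]_(m, d)) (xi : 'cV[R]_dP) (i : 'I_d) :
  (forall k j, 0 <= v k j 0) -> (forall j, exists k, v k j 0 != 0) ->
  dotv (ones m) (col i H) = 0 ->
  Fmap v G H xi i 0 =
    expR (\sum_j H j i * ln (\sum_k v k j 0 * expR (dotv (v k) (G *m xi)))).
Proof.
move=> v0 vn0 Hi.
set S := fun j => \sum_k v k j 0 * expR (dotv (v k) (G *m xi)).
pose Z := \sum_k expR (dotv (v k) (G *m xi)).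
have Z0 (j : 'I_m) : 0 < Z.
  have [k _] := vn0 j; rewrite /Z (bigD1 k)//= ltr_pwDl ?expR_gt0//.
  by rewrite sumr_ge0// => p _; rewrite expR_ge0.
have S0 j : 0 < S j by apply: lse_gt0.
have sumH : \sum_j H j i * ln Z = 0.
  rewrite -mulr_suml (_ : \sum_j H j i = 0) ?mul0r// -[RHS]Hi /dotv.
  by apply: eq_bigr => j _; rewrite !mxE mul1r.
have -> : \sum_j H j i * ln (S j) = \sum_j (H j i * ln (S j) - H j i * ln Z).
  by rewrite sumrB sumH subr0.
rewrite mxE /vpow expR_sum.
apply: eq_bigr => j _; rewrite -mulrBr -ln_div ?posrE ?(Z0 j)//.
have -> : param v G xi j 0 = S j / Z.
  rewrite /param mxE mulrC; congr (_ * _); rewrite summxE.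
  by apply: eq_bigr => k _; rewrite mxE mulrC.
by rewrite powR_pos ?divr_gt0 ?(Z0 j)// mxE.
Qed.

Lemma Fmap_continuous {R : realType} {m nP dP d : nat} (v : 'I_nP -> 'cV[R]_m)
    (G : 'M[R]_(m, dP)) (H : 'M[R]_(m, d)) :
  (forall k j, 0 <= v k j 0) -> (forall j, exists k, v k j 0 != 0) ->
  (forall i, dotv (ones m) (col i H) = 0) -> continuous (Fmap v G H).
Proof.
move=> v0 vn0 Hi; apply: continuous_mx => i j; rewrite ord1.
have -> : (fun xi => Fmap v G H xi i 0) = expR \o (fun xi => \sum_j H j i *
    ln (\sum_k v k j 0 * expR (dotv (v k) (G *m xi)))).
  by apply/funext => xi /=; exact: Fmap_lse.
move=> xi; apply: continuous_comp; last exact: continuous_expR.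
apply: continuous_sum => p; apply: continuous_scale => {}xi.
apply: (@continuous_comp _ _ _
  (fun xi => \sum_k v k p 0 * expR (dotv (v k) (G *m xi))) (@ln R)); last first.
  by apply: continuous_ln; exact: lse_gt0.
apply: continuous_sum => k; apply: continuous_scale => {}xi.
apply: (@continuous_comp _ _ _ (fun xi => dotv (v k) (G *m xi)) expR).
  apply: (@continuous_comp _ _ _ (mulmx G) (dotv (v k))).
    exact: continuous_mulmx.
  exact: continuous_dotv.
exact: continuous_expR.
Qed.

Lemma ln_Fmap_mumax_bound {R : realType} {m nP dP d : nat}
    (v : 'I_nP -> 'cV[R]_m) (G : 'M[R]_(m, dP)) (H : 'M[R]_(m, d)) :
  (forall k j, 0 <= v k j 0) -> (forall j, exists k, v k j 0 != 0) ->
  (forall i, dotv (ones m) (col i H) = 0) ->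
  exists C, forall xi i,
    `|ln (Fmap v G H xi i 0) - (H^T *m mumax v (G *m xi)) i 0| <= C.
Proof.
move=> v0 vn0 Hi.
have /choice[C CP] j := lse_max_bound (fun k => v k j 0) (v0^~ j) (vn0 j).
(* Nonnegative because it bounds an absolute value, for instance at [a = 0]. *)
have C0 j : 0 <= C j by apply: le_trans (CP j (fun=> 0)).
exists (\sum_i \sum_j `|H j i| * C j) => xi i.
rewrite Fmap_lse// expRK mxE -sumrB.
apply: (@le_trans _ _ (\sum_j `|H j i| * C j)); last first.
  rewrite (bigD1 i)//= lerDl sumr_ge0// => p _.
  by rewrite sumr_ge0// => j _; rewrite mulr_ge0.
apply: le_trans (ler_norm_sum _ _ _) _; apply: ler_sum => j _.
by rewrite !mxE -mulrBr normrM ler_wpM2l.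
Qed.

Lemma mumax_scale {R : realType} {m nP : nat} (v : 'I_nP -> 'cV[R]_m)
    (s : R) (t : 'cV[R]_m) : 0 <= s -> mumax v (s *: t) = s *: mumax v t.
Proof.
move=> s0; apply/matrixP => j i; rewrite !mxE -max_over_scale//.
by congr max_over; apply/funext => k; rewrite dotvZ.
Qed.

Lemma mumax_continuous {R : realType} {m nP : nat} (v : 'I_nP -> 'cV[R]_m) :
  continuous (mumax v).
Proof.
apply: continuous_mx => j i.
rewrite [X in continuous X](_ : _ =
    fun t => max_over (fun k => v k j 0 != 0) (fun k => dotv (v k) t)).
  by apply: max_over_continuous => k; exact: continuous_dotv.
by apply/funext => t; rewrite mxE.
Qed.

Lemma dotv_mulmx {R : realType} {m d : nat} (H : 'M[R]_(m, d)) (x : 'cV[R]_m)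
    (y : 'cV[R]_d) : dotv x (H *m y) = dotv (H^T *m x) y.
Proof.
have dotvE k (a b : 'cV[R]_k) : dotv a b = (a^T *m b) 0 0.
  by rewrite mxE; apply: eq_bigr => i _; rewrite mxE.
by rewrite !dotvE trmx_mul trmxK mulmxA.
Qed.

Lemma orth_compl_im {R : realType} {m d : nat} (H : 'M[R]_(m, d))
    (x : 'cV[R]_m) : orth_compl (mx_im H) x <-> H^T *m x = 0.
Proof.
split=> [Hx|Hx _ [y _ <-]]; last first.
  by rewrite dotv_mulmx Hx /dotv big1// => i _; rewrite mxE mul0r.
apply/matrixP => i j; rewrite ord1 [RHS]mxE.
have /Hx : mx_im H (H *m delta_mx i 0) by exists (delta_mx i 0).
rewrite dotv_mulmx /dotv (bigD1 i)//= big1 => [|p pi].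
  by rewrite addr0 [delta_mx _ _ _ _]mxE !eqxx mulr1.
by rewrite [delta_mx _ _ _ _]mxE (negbTE pi) mulr0.
Qed.

(** * Properness *)

Lemma compact_ln_bound {R : realType} {d : nat} (K : set 'cV[R]_d) :
  K `<=` pos_orthant d -> compact K ->
  exists M, forall y, K y -> \sum_i `|ln (y i 0)| <= M.
Proof.
move=> Kpos Kc.
have [] : bounded_set ((fun y : 'cV[R]_d => \sum_i `|ln (y i 0)|) @` K).
  apply: compact_bounded; apply: continuous_compact => //.
  apply: continuous_in_subspaceT => y /set_mem Ky.
  apply: cvg_big => [x| |i _]; [exact: add_continuous|exact: nbhs_filter|].
  have lnc : {for y, continuous ((@ln R) \o (fun x : 'cV[R]_d => x i 0))}.
    apply: continuous_comp; first exact: coord_continuous.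
    by apply: continuous_ln; exact: Kpos.
  exact: (cvg_norm lnc).
move=> M [Mreal KM]; exists (M + 1) => y Ky.
apply: le_trans (ler_norm _) _; apply: (KM (M + 1)); first by rewrite ltrDl.
by exists y.
Qed.

(** With [f(xi)] the sum of the moduli of the coordinates of [H^T mumax(G xi)],
    coercivity gives [c |xi| <= f(xi)], while [f] differs by a bounded amount from
    the sum of the [|ln (F_i(xi))|], which is bounded on the preimage of a compact
    set. *)
Lemma proper_of_no_recession {R : realType} {m nP dP d : nat}
    (v : 'I_nP -> 'cV[R]_m) (G : 'M[R]_(m, dP)) (H : 'M[R]_(m, d)) :
  (forall k j, 0 <= v k j 0) -> (forall j, exists k, v k j 0 != 0) ->
  (forall i, dotv (ones m) (col i H) = 0) ->
  (forall xi, xi != 0 -> H^T *m mumax v (G *m xi) != 0) ->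
  proper_into (pos_orthant d) (Fmap v G H).
Proof.
move=> v0 vn0 Hi gn0 K Kpos Kc.
pose f xi := \sum_i `|(H^T *m mumax v (G *m xi)) i 0|.
have fcont : continuous f.
  have gcont : continuous (fun xi => H^T *m mumax v (G *m xi)).
    move=> xi; apply: (@continuous_comp _ _ _ (fun xi => mumax v (G *m xi))
      (mulmx H^T)); last exact: continuous_mulmx.
    apply: (@continuous_comp _ _ _ (mulmx G) (mumax v)).
      exact: continuous_mulmx.
    exact: mumax_continuous.
  apply: continuous_sum => i xi.
  have gicont := continuous_comp (gcont xi) (@coord_continuous _ _ _ i 0 _).
  exact: (cvg_norm gicont).
have fscale s xi : 0 <= s -> f (s *: xi) = s * f xi.
  move=> s0; rewrite /f mulr_sumr; apply: eq_bigr => i _.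
  by rewrite -scalemxAr mumax_scale// -scalemxAr mxE normrM ger0_norm.
have fpos xi : xi != 0 -> 0 < f xi.
  move=> /gn0 gxi; rewrite lt0r sumr_ge0// andbT.
  apply: contra gxi => /eqP/psumr_eq0P f0; apply/eqP/matrixP => i j.
  by rewrite ord1 [RHS]mxE; apply/normr0_eq0; exact: f0.
have [c c0 cle] := homogeneous_coercive f fcont fscale fpos.
have [C CP] := ln_Fmap_mumax_bound v G H v0 vn0 Hi.
have [M KM] := compact_ln_bound K Kpos Kc.
apply: cV_compact; last first.
  apply: preimage_closed; first by move=> x _; exact: Fmap_continuous.
  by apply: compact_closed => //; exact: norm_hausdorff.
exists ((M + \sum_(i < d) C) / c); split=> [|N MN xi /KM KMxi /=]; first exact: num_real.
apply: le_trans (ltW MN); rewrite ler_pdivlMr// mulrC.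
apply: le_trans (cle xi) _.
apply: (@le_trans _ _ (\sum_i `|ln (Fmap v G H xi i 0)| + \sum_(i < d) C)).
  rewrite -big_split /=; apply: ler_sum => i _.
  rewrite -lerBlDl; apply: le_trans (CP xi i).
  by rewrite distrC; exact: lerB_dist.
by rewrite lerD2r.
Qed.

(** On the ray through [xi] the main term of [ln F] vanishes, so [F] stays in the
    box with sides [e^(-C), e^C]; the preimage of this box contains the whole ray. *)
Lemma not_proper_of_recession {R : realType} {m nP dP d : nat}
    (v : 'I_nP -> 'cV[R]_m) (G : 'M[R]_(m, dP)) (H : 'M[R]_(m, d))
    (xi : 'cV[R]_dP) :
  (forall k j, 0 <= v k j 0) -> (forall j, exists k, v k j 0 != 0) ->
  (forall i, dotv (ones m) (col i H) = 0) ->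
  xi != 0 -> H^T *m mumax v (G *m xi) = 0 ->
  ~ proper_into (pos_orthant d) (Fmap v G H).
Proof.
move=> v0 vn0 Hi xi0 gxi Fproper.
have [C CP] := ln_Fmap_mumax_bound v G H v0 vn0 Hi.
pose K := [set y : 'cV[R]_d | forall i, y i 0 \in `[expR (- C), expR C]].
have Kpos : K `<=` pos_orthant d.
  move=> y Ky i; have := Ky i; rewrite in_itv /= => /andP[+ _].
  by apply: lt_le_trans; exact: expR_gt0.
have Kc : compact K.
  apply: cV_compact.
    exists (expR C); split=> // N CN y Ky; apply: le_trans (ltW CN).
    apply: norm_le_coord => [|i j]; first exact: expR_ge0.
    rewrite ord1 gtr0_norm; last exact: Kpos.
    by have := Ky i; rewrite in_itv /= => /andP[].
  have -> : K = \bigcap_(i in setT)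
      ((fun y : 'cV[R]_d => y i 0) @^-1` `[expR (- C), expR C]).
    by apply/seteqP; split=> [y Ky i _|y Ky i]; [exact: Ky|exact: Ky].
  apply: closed_bigI => i _; apply: preimage_closed.
    by move=> y _; exact: coord_continuous.
  exact: interval_closed.
have rayK s : 0 <= s -> K (Fmap v G H (s *: xi)).
  move=> s0 i; have := CP (s *: xi) i.
  rewrite -scalemxAr mumax_scale// -scalemxAr gxi scaler0 [(0 : 'cV_d) i 0]mxE subr0.
  rewrite ler_norml Fmap_lse// expRK => /andP[lo hi].
  by rewrite in_itv /= !ler_expR lo hi.
have [M [Mreal KM]] := compact_bounded (Fproper K Kpos Kc).
have nxi : 0 < `|xi| by rewrite normr_gt0.
(* [N] exceeds the bound [M], and the ray has a point of norm [N + 1]. *)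
pose N := `|M| + 1.
have MN : M < N by rewrite (le_lt_trans (ler_norm M))// ltrDl.
have N0 : 0 <= N by rewrite addr_ge0.
have := KM N MN (((N + 1) / `|xi|) *: xi) (rayK _ _).
rewrite divr_ge0 ?addr_ge0// => /(_ isT) /=.
rewrite normrZ normf_div normr_id divfK ?gt_eqF// ger0_norm ?addr_ge0//.
by rewrite gerDl ler10.
Qed.

Theorem theorem16 (R : realType) (l m n nP dP d : nat)
    (A : 'M[R]_(l, m)) (B : 'M[R]_(n, m))
    (v : 'I_nP -> 'cV[R]_m) (G : 'M[R]_(m, dP)) (H : 'M[R]_(m, d))
    (hC : coef_cone A !=set0)
    (hdP : has_dim (coef_polytope A) dP)
    (hv : enumerates_vertices v (closure (coef_polytope A)))
    (hGorth : orthonormal_cols G)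
    (hG : mx_im G = mx_ker (aug_mx A))
    (hH : basis_mx H (mx_ker (aug_mx B)))
    (hd : dP = d) :
  ~ proper_into (pos_orthant d) (Fmap v G H) <->
  exists t : 'cV[R]_m,
    [/\ t != 0, mx_ker (aug_mx A) t
      & orth_compl (mx_ker (aug_mx B)) (mumax v t)].
Proof.
have [_ vext] := hv; have [_ imH] := hH.
have v0 k j : 0 <= v k j 0.
  have [/closure_coef_polytope_sub_simplex[v0 _] _] :
    extreme_points (closure (coef_polytope A)) (v k) by rewrite -vext; exists k.
  exact: v0.
have vn0 j : exists k, v k j 0 != 0.
  have [x] := @closure_coef_polytope_vertex _ _ _ A j hC.
  by rewrite -vext => -[k _ <-]; exists k.
have Hi i : dotv (ones m) (col i H) = 0.
  have : mx_im H (col i H) by rewrite colE; exists (delta_mx i 0).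
  rewrite imH /mx_ker /= /aug_mx mul_col_mx => /eqP.
  rewrite col_mx_eq0 => /andP[_ /eqP/matrixP/(_ 0 0)].
  by rewrite !mxE => <-; apply: eq_bigr => j _; rewrite !mxE.
split=> [Fnp|[t [t0]]].
  apply: contrapT => not_t; apply: Fnp.
  apply: proper_of_no_recession => // xi xi0; apply/eqP => gxi.
  apply: not_t; exists (G *m xi); split.
  - apply: contra_neq xi0 => Gxi.
    by rewrite -[xi]mul1mx -hGorth -mulmxA Gxi mulmx0.
  - by rewrite -hG; exists xi.
  - by rewrite -imH; apply/orth_compl_im.
rewrite -hG -imH => -[xi _ Gxi]; rewrite -Gxi => /orth_compl_im gxi.
apply: not_proper_of_recession gxi => //.
by apply: contra_neq t0 => xi0; rewrite -Gxi xi0 mulmx0.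
Qed.
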